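(* Let $\mathcal{A}=(U,\mathcal{C})$ be a bouquet of downset alignments with $\ell$ maximal (by inclusion) members (for example, a median set system with $\ell$ maximal members), such that every element of $U$ belongs to some member of $\mathcal{C}$. Then $\mathcal{A}$ is realizable and $\dim_{\mathbb{E}}(\mathcal{A})\leq\min(|U|,\ \ell\cdot\mathrm{VC\text{-}dim}(\mathcal{A}))$.
   Context: $U$ is a finite set and $\mathcal{C}\subseteq 2^U$. The pair $(U,\mathcal{C})$ is a bouquet of downset alignments if: (C1$'$) $\varnothing\in\mathcal{C}$; (C2) $X\cap Y\in\mathcal{C}$ for all $X,Y\in\mathcal{C}$; (C3$'$) for all $X,Y\in\mathcal{C}$ with $Y\subsetneq X$ there is $e\in X\setminus Y$ with $Y\cup\{e\}\in\mathcal{C}$; (C8) for all $X,Y\in\mathcal{C}$, if there is $Z\in\mathcal{C}$ with $X\cup Y\subseteq Z$, then $X\cup Y\in\mathcal{C}$. A median set system is a pair $(U,\mathcal{C})$ satisfying (C1$'$), (C2), (C6) for any $x\neq y$ in $U$ there is $K\in\mathcal{C}$ with $|\{x,y\}\cap K|=1$, and (C7) if $K_i,M_i\in\mathcal{C}$ ($i=1,2,3$) satisfy $K_i\cup K_j\subseteq M_k$ whenever $\{i,j,k\}=\{1,2,3\}$, then $K_1\cup K_2\cup K_3\in\mathcal{C}$. Median set systems are bouquets of downset alignments. The VC-dimension of $\mathcal{C}$ is the maximum size of $X\subseteq U$ with $\{S\cap X:S\in\mathcal{C}\}=2^X$. A realization of $\mathcal{C}\subseteq 2^U$ in $\mathbb{R}^m$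 consists of oriented affine hyperplanes $(H_e)_{e\in U}$ of $\mathbb{R}^m$, where $H_e=\{x:a_e\cdot x=b_e\}$ with $a_e\neq 0$, $H_e^+=\{x:a_e\cdot x>b_e\}$, $H_e^-=\{x:a_e\cdot x<b_e\}$, and a relatively open convex set $K\subseteq\mathbb{R}^m$ such that $X\subseteq U$ belongs to $\mathcal{C}$ if and only if there is $x\in K$ with $x\in H_e^+$ for all $e\in X$ and $x\in H_e^-$ for all $e\in U\setminus X$. $\mathcal{C}$ is realizable if it has a realization in some $\mathbb{R}^m$, and the Euclidean dimension $\dim_{\mathbb{E}}$ is the smallest such $m$. *)

(* Defs.v *)
From mathcomp Require Import all_boot all_order all_algebra.
From mathcomp Require Import all_classical all_reals all_analysis.
Set Implicit Arguments.
Unset Strict Implicit.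
Unset Printing Implicit Defensive.
Import Order.TTheory GRing.Theory Num.Theory.
Import numFieldNormedType.Exports.

Section SetSystems.
Context {U : finType}.
Implicit Types (C : {set {set U}}) (X Y Z : {set U}).

(* A set system (U, C) is given by its ground set, the finite type U, and the
   family C of subsets of U. *)
Record bouquet_of_downset_alignments C : Prop := BouquetOfDownsetAlignments {
  bouquet_set0 : finset.set0 \in C;
  bouquet_setI X Y : X \in C -> Y \in C -> X :&: Y \in C;
  bouquet_extend X Y : X \in C -> Y \in C -> Y \proper X ->
    exists2 e, e \in X :\: Y & Y :|: [set e] \in C;
  bouquet_setU X Y : X \in C -> Y \in C ->
    (exists2 Z, Z \in C & X :|: Y \subset Z) -> X :|: Y \in C
}.

Record median_set_system C : Prop := MedianSetSystem {
  median_set0 : finset.set0 \in C;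
  median_setI X Y : X \in C -> Y \in C -> X :&: Y \in C;
  median_separate (x y : U) : x != y ->
    exists2 K, K \in C & #|[set x; y] :&: K| = 1%N;
  median_setU3 K1 K2 K3 M1 M2 M3 :
    K1 \in C -> K2 \in C -> K3 \in C -> M1 \in C -> M2 \in C -> M3 \in C ->
    K1 :|: K2 \subset M3 -> K1 :|: K3 \subset M2 -> K2 :|: K3 \subset M1 ->
    K1 :|: K2 :|: K3 \in C
}.

Definition maximal_members C : {set {set U}} :=
  [set X | maxset (fun Y => Y \in C) X].

Definition shattered C X : bool := [set S :&: X | S in C] == powerset X.

(* A nonempty C shatters the empty set, so the maximum below is attained. *)
Definition VC_dim C : nat := \max_(X : {set U} | shattered C X) #|X|.

Lemma median_bouquet C :
  median_set_system C -> bouquet_of_downset_alignments C.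
Proof.
move=> [C0 CI Csep CU3].
have CU X Y : X \in C -> Y \in C ->
    (exists2 Z, Z \in C & X :|: Y \subset Z) -> X :|: Y \in C.
  move=> XC YC [Z ZC XYZ].
  have := CU3 X Y finset.set0 Y X Z XC YC C0 YC XC ZC XYZ.
  by rewrite !finset.setU0; apply.
split=> // X Y XC YC YX.
pose P W := [&& W \in C, Y \proper W & W \subset X].
have PX : P X by rewrite /P XC YX subxx.
have [Z /minsetP[/and3P[ZC YZ ZX] Zmin] _] := minset_exists PX.
have [e eZ eY] : exists2 e, e \in Z & e \notin Y by case/properP: YZ.
exists e; first by rewrite inE eY (fintype.subsetP ZX).
suff -> : Y :|: [set e] = Z by [].
apply/eqP; rewrite finset.eqEsubset finset.subUset (proper_sub YZ).
rewrite finset.sub1set eZ.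
apply/fintype.subsetP => f fZ; rewrite !inE; apply/norP => -[fY fe].
have [K KC] := Csep _ _ fe.
have key g h : g \in Z -> g \notin Y -> h \in Z -> h \notin Y ->
    g \in K -> h \notin K -> False.
  move=> gZ gY hZ hY gK hK.
  have KZC := CI _ _ KC ZC.
  have sub : Y :|: (K :&: Z) \subset Z.
    by rewrite finset.subUset (proper_sub YZ) finset.subsetIr.
  have PW : P (Y :|: (K :&: Z)).
    apply/and3P; split; last exact: fintype.subset_trans ZX.
      by apply: CU => //; exists Z.
    apply/properP; split; first exact: finset.subsetUl.
    by exists g => //; rewrite !inE gK gZ orbT.
  have WZ := Zmin _ PW sub; move: hZ; rewrite -WZ !inE (negPf hY) (negPf hK).
  by [].
have [fK|fK] := boolP (f \in K); have [eK|eK] := boolP (e \in K); last first.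
- suff -> : [set f; e] :&: K = finset.set0 by rewrite cards0.
  apply/setP => x; rewrite !inE; apply/negbTE/negP => /andP[/orP[]/eqP->].
    by rewrite (negPf fK).
  by rewrite (negPf eK).
- by move=> _; apply: (key e f).
- by move=> _; apply: (key f e).
- suff /finset.setIidPl -> : [set f; e] \subset K.
    by rewrite cards2 fe.
  by rewrite finset.subUset !finset.sub1set fK eK.
Qed.

End SetSystems.

Section Euclidean.
Context {R : realType}.
Local Open Scope classical_set_scope.
Local Open Scope ring_scope.

Definition dot m (u v : 'rV[R]_m) : R := \sum_(i < m) u 0 i * v 0 i.

Definition pos_side m (a : 'rV[R]_m) (b : R) : set 'rV[R]_m :=
  [set x | dot a x > b].

Definition neg_side m (a : 'rV[R]_m) (b : R) : set 'rV[R]_m :=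
  [set x | dot a x < b].

(* Closure under lines through two points; over a field of characteristic 0
   these are exactly the affine subspaces, together with the empty set. *)
Definition affine_set m (A : set 'rV[R]_m) : Prop :=
  forall x y (t : R), A x -> A y -> A (t *: x + (1 - t) *: y).

Definition affine_hull m (A : set 'rV[R]_m) : set 'rV[R]_m :=
  smallest (@affine_set m) A.

Definition relatively_open m (A : set 'rV[R]_m) : Prop :=
  exists2 O : set 'rV[R]_m, open O & A = O `&` affine_hull A.

End Euclidean.

Section Realizability.
Variable R : realType.
Context {U : finType}.
Implicit Type C : {set {set U}}.
Local Open Scope ring_scope.

Definition realization C m (a : U -> 'rV[R]_m) (b : U -> R)
    (K : set 'rV[R]_m) : Prop :=
  [/\ forall e, a e != 0,
      convex_set K,
      relatively_open K
    & forall X : {set U}, X \in C <->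
        exists x, [/\ K x,
          forall e, e \in X -> pos_side (a e) (b e) x
        & forall e, e \notin X -> neg_side (a e) (b e) x]].

Definition realizable_in C (m : nat) : Prop :=
  exists a b K, @realization C m a b K.

Definition realizable C : Prop := exists m, realizable_in C m.

Definition is_euclidean_dim C (d : nat) : Prop :=
  realizable_in C d /\ forall m, realizable_in C m -> (d <= m)%N.

End Realizability.

(* Main.v *)
Require Import Defs.
From mathcomp Require Import all_boot all_order all_algebra.
From mathcomp Require Import all_classical all_reals all_analysis.
From mathcomp Require Import ring lra.
Set Implicit Arguments.
Unset Strict Implicit.
Unset Printing Implicit Defensive.
Import Order.TTheory GRing.Theory Num.Theory.
Import numFieldNormedType.Exports.
Import fintype finset.

(* Say that f <= e when every member containing e contains f. This is a partial
   order, and the members are exactly the downsets contained in some member. An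
   antichain inside a member is shattered, so by Dilworth's theorem each maximal
   member is covered by VC-dim chains; alternatively U is covered by its |U|
   singletons. So it suffices to realize, in R^m, a system whose ground set is
   covered by m chains c_1, ..., c_m.

   Put v_j(f) = sum of B^h(e) over the e in c_j with e <= f, where h(e) is the
   size of the principal downset of e and B is large, and let the positive side
   of H_f be sum_j v_j(f) x_j < 1. As v_j is increasing, every cell of the open
   positive orthant is a downset. The functions 1 - sum_j v_j(f) x_j are at most
   1 on the orthant but can be made very negative outside a given downset; hence
   the linear constraints sum_(f in N) (1 - sum_j v_j(f) x_j) < 0, for the N
   contained in no member, exclude the cells outside C and keep those in C. *)

(** * Dilworth's theorem for finite posets *)

Section Posets.
Context {U : finType}.
Variable le : rel U.
Implicit Types (A M X : {set U}).

Definition chain A := forall x y, x \in A -> y \in A -> le x y || le y x.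

Definition antichain A := forall x y, x \in A -> y \in A -> le x y -> x = y.

Hypotheses (le_refl : reflexive le) (le_anti : antisymmetric le)
  (le_trans : transitive le).

Lemma maximal_elt M x0 : x0 \in M ->
  exists2 x, x \in M & forall y, y \in M -> le x y -> y = x.
Proof.
move=> x0M; pose up x := #|[set y | le x y]|.
case: (arg_minnP up x0M) => x xM xmin; exists x => // y yM xy.
apply/eqP/negPn/negP => neyx; have := xmin _ yM; rewrite leqNgt => /negP; apply.
apply/proper_card/properP; split.
  by apply/subsetP => z; rewrite !inE; apply: le_trans.
exists x; rewrite !inE ?le_refl //; apply: contra neyx => yx.
by apply/eqP/le_anti; rewrite yx xy.
Qed.

Definition chain_coloring M k (c : U -> nat) :=
  (forall x, x \in M -> c x < k) /\
  (forall x y, x \in M -> y \in M -> c x = c y -> le x y || le y x).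

Lemma chain_coloring_add M K k (c : U -> nat) :
  chain K -> chain_coloring (M :\: K) k c ->
  chain_coloring M k.+1 (fun x => if x \in K then k else c x).
Proof.
move=> chK [ck cc]; split=> [x xM|x y xM yM].
  by case: ifPn => // xK; apply/ltnW/ck; rewrite inE xK.
have inD z : z \in M -> z \notin K -> z \in M :\: K.
  by move=> ? ?; rewrite inE; apply/andP.
case: ifPn => xK; case: ifPn => yK; first by move=> _; apply: chK.
- by move=> kE; have := ck _ (inD _ yM yK); rewrite -kE ltnn.
- by move=> kE; have := ck _ (inD _ xM xK); rewrite kE ltnn.
- by apply: cc; apply: inD.
Qed.

(** Pigeonhole: a colour class is a chain, so [A] has at most one element of each of the [k]
    colours. *)
Lemma antichain_meets_color M A k c i :
  chain_coloring M k c -> antichain A -> A \subset M -> #|A| = k -> i < k ->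
  exists2 x, x \in A & c x = i.
Proof.
move=> [ck cc] acA /subsetP AM Ak ik.
have ck' (x : U) : x \in A -> c x < k by move=> xA; apply/ck/AM.
case: k => // k in Ak ik ck ck' *.
pose f x : 'I_k.+1 := inord (c x).
have fE x : x \in A -> f x = c x :> nat by move=> xA; rewrite inordK ?ck'.
have finj : {in A &, injective f}.
  move=> x y xA yA /(congr1 val) /=; rewrite !fE // => cxy.
  by case/orP: (cc _ _ (AM _ xA) (AM _ yA) cxy) => [/acA|/acA ->//]; apply.
have : f @: A == [set: 'I_k.+1]%SET.
  by rewrite eqEcard finset.subsetT card_in_imset // Ak cardsT card_ord
    leqnn.
move=> /eqP imf; have : inord i \in f @: A by rewrite imf inE.
case/imsetP => x xA fx; exists x => //.
by rewrite -fE // -fx inordK.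
Qed.

(** Galvin's argument, by induction on the size of [M]: colour [M] without a maximal element [a],
    and let [t i] be the highest element of colour [i] that lies in an antichain of full size. Some
    [t i] is below [a], and [a] with the elements of colour [i] up to [t i] is a chain to remove. *)
Lemma dilworth M k :
  (forall A, A \subset M -> antichain A -> #|A| <= k) ->
  exists c, chain_coloring M k c.
Proof.
have [n] := ubnP #|M|; elim: n M k => // n IH M k.
rewrite ltnS => Mn wM.
have [->|[a0 /maximal_elt[a aM amax]]] := set_0Vmem M.
  by exists (fun=> 0); split=> x; rewrite inE.
case: k wM => [|k] wM.
  have: antichain [set a] by move=> x y /set1P-> /set1P->.
  by move=> /wM; rewrite finset.sub1set aM cards1 => /(_ isT).
have subM A K : A \subset M :\: K -> A \subset M.
  by move=> AK; apply: fintype.subset_trans AK (finset.subsetDl _ _).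
have ltD (K : {set U}) : a \in K -> #|M :\: K| < n.
  move=> aK; apply: leq_trans Mn; apply: proper_card; apply/properP.
  by split; [exact: finset.subsetDl | exists a => //; rewrite inE aK].
(* It is enough to remove a chain through a that meets every antichain of
   maximal size. *)
have rm (K : {set U}) : a \in K -> chain K ->
    (forall A, A \subset M :\: K -> antichain A -> #|A| = k.+1 -> False) ->
    exists c, chain_coloring M k.+1 c.
  move=> aK chK hK; have [||c cP] := IH (M :\: K) k; first exact: ltD.
    move=> A AM acA; have := wM A (subM _ _ AM) acA.
    by rewrite leq_eqVlt => /orP[/eqP/(hK _ AM acA)|].
  by exists (fun x => if x \in K then k else c x); apply: chain_coloring_add.
have [c cP] : exists c, chain_coloring (M :\ a) k.+1 c.
  apply: IH; first by apply: ltD; rewrite inE.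
  by move=> A AM; apply/wM/(subM _ _ AM).
pose big A := [/\ A \subset M :\ a, antichain A & #|A| = k.+1].
have [[A0 bigA0]|nobig] := pselect (exists A, big A); last first.
  apply: (rm [set a]); first by rewrite inE.
    by move=> x y /set1P-> /set1P->; rewrite le_refl.
  by move=> A AM acA Ak; apply: nobig; exists A.
have meet A i : big A -> i < k.+1 -> exists2 x, x \in A & c x = i.
  by case=> ? ? ?; apply: (antichain_meets_color cP).
pose V i : {set U} := [set x | (c x == i) && `[< exists2 A, big A & x \in A >]].
have top (i : 'I_k.+1) : exists x, [/\ c x = i, exists2 A, big A & x \in A &
    forall A y, big A -> y \in A -> c y = i -> le y x].
  have [x0 x0A cx0] := meet _ i bigA0 (ltn_ord i).
  have x0V : x0 \in V i.
    by rewrite inE cx0 eqxx; apply/asboolP; exists A0.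
  have [x] := maximal_elt x0V.
  rewrite inE => /andP[/eqP cx /asboolP[A bA xA]] xmax.
  exists x; split=> //; first by exists A.
  move=> B y bB yB cy.
  have yV : y \in V i by rewrite inE cy eqxx; apply/asboolP; exists B.
  have [_ cc] := cP.
  have := cc x y; rewrite cx cy; case: bA bB => AM _ _ [BM _ _].
  move=> /(_ (subsetP AM _ xA) (subsetP BM _ yB) erefl)/orP[|//].
  by move=> xy; rewrite (xmax y yV xy) le_refl.
have [t tP] := choice top.
have tM i : t i \in M :\ a.
  by have [_ [A [AM _ _] /(subsetP AM)]] := tP i.
have tinj : injective t.
  move=> i j tij; apply: val_inj => /=.
  by have [<- _ _] := tP i; have [<- _ _] := tP j; rewrite tij.
(* The antichain through [t j] has an element of colour [i], which is below [t i], hence below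
   [t j], hence equal to [t j]. *)
have tanti i j : le (t i) (t j) -> t i = t j.
  move=> tij; have [cj [A bA tA] _] := tP j; have [_ _ imax] := tP i.
  have [y yA cy] := meet A i bA (ltn_ord i).
  have yi := imax A y bA yA cy.
  have [_ acA _] := bA.
  have yj : y = t j by apply: acA => //; apply: le_trans tij.
  by apply: le_anti; rewrite tij -yj.
(* Otherwise [a] and all the [t i] form an antichain of [k.+2] elements in [M]. *)
have [i ti_a] : exists i, le (t i) a.
  apply: contrapT => nta.
  have nat i : le (t i) a -> False by move=> h; apply: nta; exists i.
  pose A := a |: [set t i | i : 'I_k.+1].
  have := wM A; rewrite /A cardsU1 card_imset // card_ord.
  have -> : a \notin [set t i | i : 'I_k.+1].
    by apply/imsetP => -[i _ aE]; apply: (nat i); rewrite -aE.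
  rewrite add1n ltnn => /(_ _ _)/negP; apply=> //.
    rewrite finset.subUset finset.sub1set aM; apply/subsetP => _ /imsetP[i _ ->].
    by have := tM i; rewrite inE => /andP[].
  have tM' i : t i \in M by have := tM i; rewrite inE => /andP[].
  move=> x y /setU1P[->|/imsetP[i _ ->]] /setU1P[->|/imsetP[j _ ->]] //.
  - by move=> aj; rewrite (amax _ (tM' j) aj).
  - by move/nat.
  - exact: tanti.
have [ci _ imax] := tP i.
apply: (rm (a |: [set z in M :\ a | (c z == i) && le z (t i)])).
- by rewrite !inE eqxx.
- have [_ cc] := cP.
  have below z : z \in [set z in M :\ a | (c z == i) && le z (t i)] -> le z a.
    by rewrite inE => /and3P[_ _ zt]; apply: le_trans ti_a.
  move=> x y /setU1P[->|xC] /setU1P[->|yC]; rewrite ?le_refl ?below ?orbT //.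
  move: xC yC; rewrite !(inE, in_setD1) => /and3P[xM /eqP cx _] /and3P[yM /eqP cy _].
  by apply: cc; rewrite ?inE ?cx ?cy.
- move=> A AM acA Ak.
  have bA : big A.
    split=> //; apply/subsetP => x /(subsetP AM); rewrite !inE.
    by case/andP => + ->; rewrite negb_or => /andP[->].
  have [y yA cy] := meet A i bA (ltn_ord i).
  have yt := imax _ _ bA yA cy; have [/subsetP/(_ _ yA) yM _ _] := bA.
  have := subsetP AM _ yA; move: yM.
  by rewrite !inE => /andP[/negPf-> ->]; rewrite yt cy eqxx.
Qed.

End Posets.

(** * Members of a bouquet as bounded downsets *)

Section Bouquets.
Context {U : finType}.
Variable C : {set {set U}}.
Hypotheses (bC : bouquet_of_downset_alignments C)
  (coverC : forall e : U, exists2 X : {set U}, X \in C & e \in X).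
Implicit Types (X Y Z A : {set U}).

Definition forced (f e : U) := [forall X in C, (e \in X) ==> (f \in X)].

Lemma forcedP f e :
  reflect (forall X, X \in C -> e \in X -> f \in X) (forced f e).
Proof.
apply: (iffP forall_inP) => h X XC; first by apply/implyP/h.
by apply/implyP/h.
Qed.

Lemma forced_refl : reflexive forced.
Proof. by move=> e; apply/forcedP. Qed.

Lemma forced_trans : transitive forced.
Proof.
by move=> f e g /forcedP ef /forcedP fg; apply/forcedP => X XC /fg/ef; apply.
Qed.

Definition principal e : {set U} := [set f | forced f e].

(** Closure under intersection makes a minimal member containing [e] the least one, which is the
    principal downset. *)
Lemma principal_mem e : principal e \in C.
Proof.
have [X0 X0C eX0] := coverC e.
have P0 : (X0 \in C) && (e \in X0) by rewrite X0C.
have [Z /minsetP[/andP[ZC eZ] Zmin] _] :=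
  @minset_exists _ (fun X => (X \in C) && (e \in X)) _ P0.
suff -> : principal e = Z by [].
apply/setP => f; rewrite inE; apply/forcedP/idP => [|fZ X XC eX]; first exact.
have := Zmin (X :&: Z); rewrite bouquet_setI // inE eX eZ.
by move=> /(_ isT (finset.subsetIr _ _)) XZ; move: fZ; rewrite -XZ inE => /andP[].
Qed.

Lemma principal_sub e X : X \in C -> e \in X -> principal e \subset X.
Proof. by move=> XC eX; apply/subsetP => f; rewrite inE => /forcedP; apply. Qed.

(** This rests on one-element extension: a maximal member [W] inside [principal e] that misses [e]
    can only be extended there by [e] itself. The result contains [f]; if [f] is not [e], it is
    already in [W] and forces [e] into [W]. *)
Lemma forced_anti : antisymmetric forced.
Proof.
move=> f e /andP[/forcedP fe /forcedP ef]; apply/eqP/negPn/negP => nfe.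
pose P X := [&& X \in C, X \subset principal e & e \notin X].
have P0 : P finset.set0 by rewrite /P bouquet_set0 // finset.sub0set inE.
have [W /maxsetP[/and3P[WC We eW] Wmax] _] := maxset_exists P0.
have ee : e \in principal e by rewrite inE forced_refl.
have [|g /setDP[gZ gW] WgC] := bouquet_extend bC (principal_mem e) WC.
  by apply/properP; split=> //; exists e.
have [eWg|neWg] := boolP (e \in W :|: [set g]).
  have eg : e = g by move: eWg; rewrite !inE (negPf eW) => /eqP.
  have := fe _ WgC eWg; rewrite !inE -eg (negPf nfe) orbF => fW.
  by rewrite (ef _ WC fW) in eW.
have PWg : P (W :|: [set g]).
  by rewrite /P WgC neWg finset.subUset We finset.sub1set gZ.
by move: gW; rewrite -(Wmax _ PWg (finset.subsetUl _ _)) !inE eqxx orbT.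
Qed.

(** A downset inside a member [Z] is the union of the principal downsets of its elements; these lie
    in [Z], so their unions stay in [C]. *)
Lemma bouquetE X : X \in C <->
  (exists2 Z, Z \in C & X \subset Z) /\
  (forall e f, e \in X -> forced f e -> f \in X).
Proof.
split=> [XC|[[Z ZC /subsetP XZ] downX]].
  by split=> [|e f eX /forcedP]; [exists X | apply].
pose P W := (W \in C) && (W \subset Z).
suff: P (\bigcup_(e in X) principal e)%SET.
  suff -> : (\bigcup_(e in X) principal e)%SET = X by case/andP.
  apply/setP => f; apply/bigcupP/idP => [[e eX]|fX].
    by rewrite inE; apply: downX.
  by exists f => //; rewrite inE forced_refl.
apply: (big_ind P) => [|V W /andP[VC VZ] /andP[WC WZ]|e eX].
- by rewrite /P bouquet_set0 // finset.sub0set.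
- rewrite /P finset.subUset VZ WZ !andbT; apply: (bouquet_setU bC) => //.
  by exists Z => //; rewrite finset.subUset VZ.
- by rewrite /P principal_mem principal_sub // XZ.
Qed.

(** A subset [B] of [A] is the trace on [A] of the downset that it generates, a member because it
    lies in [Z]. *)
Lemma antichain_VC_dim Z A : Z \in C -> A \subset Z -> antichain forced A ->
  #|A| <= VC_dim C.
Proof.
move=> ZC AZ acA; apply: (@leq_bigmax_cond _ (shattered C) (fun X => #|X|) A).
rewrite /shattered finset.eqEsubset; apply/andP; split; apply/subsetP => B.
  by case/imsetP => S _ ->; rewrite inE finset.subsetIr.
rewrite inE => BA; apply/imsetP.
exists [set f | [exists e in B, forced f e]].
  apply/bouquetE; split=> [|e f].
    exists Z => //; apply/subsetP => f; rewrite inE => /exists_inP[e eB /forcedP].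
    by apply=> //; apply/(subsetP AZ)/(subsetP BA).
  rewrite !inE => /exists_inP[g gB eg] fe; apply/exists_inP.
  by exists g => //; apply: forced_trans eg.
apply/setP => f; rewrite !inE; apply/idP/andP => [fB|[/exists_inP[e eB fe] fA]].
  rewrite (subsetP BA) //; split=> //; apply/exists_inP.
  by exists f; rewrite ?forced_refl.
by rewrite (acA f e) // (subsetP BA).
Qed.

Lemma chain_cover :
  exists ch : 'I_#|maximal_members C| * 'I_(VC_dim C) -> {set U},
  (forall j, chain forced (ch j)) /\ (forall e, exists j, e \in ch j).
Proof.
have colP (i : 'I_#|maximal_members C|) :
    exists c, chain_coloring forced (enum_val i) (VC_dim C) c.
  apply: dilworth => [||| A];
    [exact: forced_refl | exact: forced_anti | exact: forced_trans |].
  have := enum_valP i; rewrite inE => /maxsetP[MC _].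
  exact: antichain_VC_dim.
have [c cP] := choice colP.
exists (fun j : 'I_#|maximal_members C| * 'I_(VC_dim C) =>
  [set e in (enum_val j.1 : {set U}) | c j.1 e == j.2 :> nat]); split.
  move=> [i k] x y; rewrite !inE /= => /andP[xM /eqP cx] /andP[yM /eqP cy].
  by have [_ cc] := cP i; apply: cc; rewrite ?cx ?cy.
move=> e; have [X XC eX] := coverC e.
have [M maxM XM] := @maxset_exists _ (fun Y => Y \in C) _ XC.
have MC : M \in maximal_members C by rewrite inE.
have eM := subsetP XM _ eX.
pose i := enum_rank_in MC M.
have iE : enum_val i = M by rewrite enum_rankK_in.
have [ck _] := cP i; have cek : c i e < VC_dim C by apply: ck; rewrite iE.
by exists (i, Ordinal cek); rewrite inE /= iE eM /=.
Qed.

End Bouquets.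

(** * Open polyhedra are convex and relatively open *)

Section OpenPolyhedra.
Context {R : realType} {m : nat}.
Local Open Scope ring_scope.
Local Open Scope classical_set_scope.
Implicit Types (a x y : 'rV[R]_m).

Lemma dotDr a x y (s t : R) :
  dot a (s *: x + t *: y) = s * dot a x + t * dot a y.
Proof.
by rewrite /dot !mulr_sumr -big_split /=; apply: eq_bigr => i _; rewrite !mxE; ring.
Qed.

Lemma dotNl a x : dot (- a) x = - dot a x.
Proof. by rewrite /dot -sumrN; apply: eq_bigr => i _; rewrite mxE mulNr. Qed.

Lemma dot_suml (I : finType) (P : pred I) (a : I -> 'rV[R]_m) x :
  dot (\sum_(i | P i) a i) x = \sum_(i | P i) dot (a i) x.
Proof.
rewrite /dot exchange_big /=; apply: eq_bigr => j _.
by rewrite summxE mulr_suml.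
Qed.

Lemma dot_delta j x : dot (delta_mx 0 j) x = x 0 j.
Proof.
rewrite /dot (bigD1 j) //= big1 => [|i ij]; rewrite mxE !eqxx ?mul1r ?addr0 //.
by rewrite (negPf ij) mul0r.
Qed.

Lemma dot_continuous a : continuous (dot a).
Proof.
have cD : continuous (fun x : R * R => x.1 + x.2)
  by move=> z; apply: cvgD; [exact: cvg_fst | exact: cvg_snd].
apply: (@continuous_big R^o 'I_m +%R 0 xpredT cD) => i _ x.
apply: (@continuous_comp _ _ _ (fun y : 'rV[R]_m => y 0 i) ( *%R (a 0 i))).
  exact: coord_continuous.
exact: mulrl_continuous.
Qed.

Definition open_polyhedron (I : finType) (P : pred I) (a : I -> 'rV[R]_m)
    (c : I -> R) : set 'rV[R]_m :=
  [set x | forall i, P i -> c i < dot (a i) x].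

Variables (I : finType) (P : pred I) (a : I -> 'rV[R]_m) (c : I -> R).

Lemma open_polyhedron_open : open (open_polyhedron P a c).
Proof.
rewrite openE => x Kx.
apply: (@filter_forall _ I (fun i y => P i -> c i < dot (a i) y) (nbhs x)) => i.
have [Pi|/negP nPi] := boolP (P i); last by apply: nearW => y Pi.
have := cvgr_gt _ (@dot_continuous (a i) x) _ (Kx i Pi).
by move=> /(_ (nbhs_filter x)); apply: filterS => y cy _; exact: cy.
Qed.

Lemma open_polyhedron_convex : convex_set (open_polyhedron P a c).
Proof.
apply/convex_setW => x y; rewrite !inE => Kx Ky k k0 k1; rewrite inE => i Pi.
have -> : conv k x y = k%:num *: x + (1 - k%:num) *: y by [].
rewrite dotDr; move: (Kx i Pi) (Ky i Pi) => /= cx cy.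
by nra.
Qed.

Lemma open_relatively_open (K : set 'rV[R]_m) : open K -> relatively_open K.
Proof.
move=> oK; exists K => //; rewrite setIidl //; exact: sub_gen_smallest.
Qed.

End OpenPolyhedra.

(** * Realization from a cover by [m] chains *)

Section ChainCoverRealization.
Context {R : realType} {U : finType} {m : nat}.
Variables (le : rel U) (C : {set {set U}}) (ch : 'I_m -> {set U}).
Hypotheses (refl_le : reflexive le) (anti_le : antisymmetric le)
  (trans_le : transitive le).
Hypothesis CE : forall X, X \in C <->
  (exists2 Z, Z \in C & X \subset Z) /\ (forall e f, e \in X -> le f e -> f \in X).
Hypotheses (ch_chain : forall j, chain le (ch j))
  (ch_cover : forall e, exists j, e \in ch j).
Local Open Scope ring_scope.
Implicit Types (X Y Z N : {set U}).

Let n := #|U|.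
Let height e := #|[set f | le f e]|.
(** For [e] in a downset [X], each of the [m] coordinates adds at most [n * n.+2 / B] to the product
    of [weight e] with the point chosen for [X]; this [B] keeps the total below 1. *)
Let B : R := (m * (n * n.+2)).+1%:R.

Definition weight e : 'rV[R]_m :=
  \row_j \sum_(g in ch j | le g e) B ^+ height g.

Let B_ge1 : 1 <= B. Proof. by rewrite /B ler1n. Qed.

Let B_gt0 : 0 < B. Proof. exact: lt_le_trans B_ge1. Qed.

Lemma height_lt f e : le f e -> f != e -> (height f < height e)%N.
Proof.
move=> fe nfe; apply/proper_card/properP; split.
  by apply/subsetP => g; rewrite !inE => /trans_le; apply.
exists e; rewrite !inE ?refl_le //; apply: contra nfe => ef.
by apply/eqP/anti_le; rewrite fe ef.
Qed.

Lemma weight_ge0 e j : 0 <= weight e 0 j.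
Proof. by rewrite mxE sumr_ge0 // => g _; rewrite exprn_ge0 ?ltW. Qed.

Lemma weight_ge e j : e \in ch j -> B ^+ height e <= weight e 0 j.
Proof.
move=> ej; rewrite mxE (bigD1 e) ?ej ?refl_le //= lerDl sumr_ge0 // => g _.
by rewrite exprn_ge0 ?ltW.
Qed.

Lemma weight_homo f e j : le f e -> weight f 0 j <= weight e 0 j.
Proof.
move=> fe; rewrite !mxE; rewrite [leRHS](bigID (le^~ f)) /=.
rewrite (eq_bigl (fun g => (g \in ch j) && le g e && le g f)).
  by rewrite lerDl sumr_ge0 // => g _; rewrite exprn_ge0 ?ltW.
move=> g /=; rewrite -andbA; congr (_ && _).
by apply/idP/andP => [gf|[]//]; split=> //; apply: trans_le fe.
Qed.

Lemma dot_weight_homo f e (x : 'rV[R]_m) : (forall j, 0 < x 0 j) -> le f e ->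
  dot (weight f) x <= dot (weight e) x.
Proof.
by move=> x0 fe; apply: ler_sum => j _; apply: ler_wpM2r (weight_homo j fe); apply: ltW.
Qed.

Section Point.
Variable X : {set U}.
Hypothesis downX : forall e f, e \in X -> le f e -> f \in X.

(** Elements of [ch j] outside [X] lie strictly above those inside, so their heights reach [t j];
    the successor leaves a factor [B] to spare inside. The value is 0 if [ch j] misses [X]. *)
Let t j := (\max_(g in ch j :&: X) (height g).+1)%N.

(* Coordinate j puts the elements of [ch j] outside [X], whose heights are at
   least [t j], beyond their hyperplanes, and keeps those in [X] well below. *)
Definition cell_point : 'rV[R]_m := \row_j (n.+2%:R / B ^+ t j).

Lemma cell_point_gt0 j : 0 < cell_point 0 j.
Proof. by rewrite mxE divr_gt0 ?ltr0n ?exprn_gt0. Qed.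

Lemma dot_cell_point_ge0 e : 0 <= dot (weight e) cell_point.
Proof. by apply: sumr_ge0 => j _; rewrite mulr_ge0 ?weight_ge0 ?ltW ?cell_point_gt0. Qed.

(** The coordinate of a chain through [e] gives at least [n.+2] by itself. A bound of 1 would not
    do: one such [e] has to outweigh [#|N|], at most [n], in the constraint of a set [N]. *)
Lemma dot_cell_point_out e : e \notin X -> n.+1%:R < dot (weight e) cell_point.
Proof.
move=> eX; have [j ej] := ch_cover e.
apply: (@lt_le_trans _ _ n.+2%:R); first by rewrite ltr_nat.
rewrite /dot (bigD1 j) //=; apply: ler_wpDr.
  by apply: sumr_ge0 => i _; rewrite mulr_ge0 ?weight_ge0 ?ltW ?cell_point_gt0.
rewrite [cell_point 0 j]mxE mulrCA ler_peMr ?ler0n // ler_pdivlMr ?exprn_gt0 // mul1r.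
apply: le_trans (weight_ge ej); apply: ler_weXn2l => //.
apply/bigmax_leqP => g; rewrite inE => /andP[gj gX].
apply: height_lt; last by apply: contraNneq eX => <-.
by case/orP: (ch_chain gj ej) => // eg; rewrite (downX gX eg) in eX.
Qed.

(** Chain elements below [e] are in [X], so each of these at most [n] powers of [B] is at most
    [B ^+ t j / B]. *)
Lemma dot_cell_point_in e : e \in X -> dot (weight e) cell_point < 1.
Proof.
move=> eX.
have bnd j : weight e 0 j * cell_point 0 j <= (n * n.+2)%:R / B.
  rewrite [cell_point 0 j]mxE natrM [leLHS]mulrCA [leRHS]mulrAC [leRHS]mulrC.
  rewrite ler_wpM2l ?ler0n // ler_pdivrMr ?exprn_gt0 // mxE.
  apply: (@le_trans _ _ (\sum_(g : U) B ^+ t j / B)); last first.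
    by rewrite sumr_const -/n -[leLHS]mulr_natl mulrA mulrAC.
  rewrite [leLHS]big_mkcond; apply: ler_sum => g _.
  case: ifPn => [/andP[gj ge]|_]; last by rewrite divr_ge0 ?exprn_ge0 ?ltW.
  rewrite ler_pdivlMr // -exprSr ler_weXn2l //.
  by apply: leq_bigmax_cond; rewrite inE gj (downX eX ge).
apply: (@le_lt_trans _ _ (\sum_(j < m) (n * n.+2)%:R / B)).
  by apply: ler_sum => j _.
rewrite sumr_const card_ord -[ltLHS]mulr_natl mulrA -natrM ltr_pdivrMr // mul1r.
by rewrite ltr_nat ltnS.
Qed.

End Point.

Lemma realizable_of_chain_cover : realizable_in R C m.
Proof.
pose bad N := ~~ [exists Z in C, N \subset Z].
pose P (i : 'I_m + {set U}) := if i is inr N then bad N else true.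
pose a (i : 'I_m + {set U}) : 'rV[R]_m :=
  match i with inl j => delta_mx 0 j | inr N => \sum_(e in N) weight e end.
pose c (i : 'I_m + {set U}) : R := if i is inr N then #|N|%:R else 0.
(* The signs are reversed because the positive side of [e] is where the product with [weight e] is
   below 1. *)
exists (fun e => - weight e), (fun=> -1), (open_polyhedron P a c); split.
- move=> e; rewrite oppr_eq0; apply/eqP => /rowP; have [j ej] := ch_cover e.
  move=> /(_ j) w0; have := weight_ge ej; rewrite w0 mxE leNgt exprn_gt0 //.
- exact: open_polyhedron_convex.
- exact/open_relatively_open/open_polyhedron_open.
move=> X; split=> [/CE[[Z ZC XZ] downX]|[x [Kx posx negx]]].
  exists (cell_point X); split=> [[j _|N badN]|e eX|e eX] /=.
  - by rewrite /= dot_delta cell_point_gt0.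
  - rewrite /c /a dot_suml.
    (* As [X] lies in a member, a bad [N] is not inside [X], and one element outside [X] suffices
       for its constraint. *)
    have [e eN eX] : exists2 e, e \in N & e \notin X.
      apply/subsetPn; apply: contra badN => NX; apply/exists_inP.
      by exists Z => //; apply: fintype.subset_trans XZ.
    rewrite (bigD1 e) //=; apply: ltr_wpDr.
      by apply: sumr_ge0 => f _; apply: dot_cell_point_ge0.
    apply: le_lt_trans (dot_cell_point_out downX eX).
    by rewrite ler_nat ltnW // ltnS max_card.
  - by rewrite /pos_side /= dotNl ltrN2 dot_cell_point_in.
  - rewrite /neg_side /= dotNl ltrN2; apply: le_lt_trans (dot_cell_point_out downX eX).
    by rewrite ler1n.
have x0 j : 0 < x 0 j by have := Kx (inl j) isT; rewrite /= dot_delta.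
have pos e : e \in X -> dot (weight e) x < 1.
  by move=> /posx; rewrite /pos_side /= dotNl ltrN2.
have neg e : e \notin X -> 1 < dot (weight e) x.
  by move=> /negx; rewrite /neg_side /= dotNl ltrN2.
apply/CE; split=> [|e f eX fe].
  (* If [X] were in no member, its own constraint would ask [#|X|] numbers below 1 to sum to more
     than [#|X|]. *)
  have [/exists_inP//|badX] := boolP [exists Z in C, X \subset Z].
  have := Kx (inr X) badX; rewrite /c /a dot_suml ltNge -sumr_const.
  by rewrite ler_sum // => e /pos/ltW.
apply: contraT => /neg; rewrite ltNge => /negP[].
exact: le_trans (dot_weight_homo x0 fe) (ltW (pos _ eX)).
Qed.

End ChainCoverRealization.

(** * Bounds on the Euclidean dimension *)

Lemma bouquet_realizable_in (R : realType) (U J : finType) (C : {set {set U}})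
    (ch : J -> {set U}) :
  bouquet_of_downset_alignments C ->
  (forall e : U, exists2 X : {set U}, X \in C & e \in X) ->
  (forall j, chain (forced C) (ch j)) -> (forall e, exists j, e \in ch j) ->
  realizable_in R C #|J|.
Proof.
move=> bC coverC ch_chain ch_cover.
apply: (@realizable_of_chain_cover R U #|J| (forced C) C (ch \o enum_val)).
- exact: forced_refl.
- exact: forced_anti.
- exact: forced_trans.
- exact: bouquetE.
- by move=> j; apply: ch_chain.
- by move=> e; have [j ej] := ch_cover e; exists (enum_rank j); rewrite /= enum_rankK.
Qed.

Lemma realizable_euclidean_dim (R : realType) (U : finType) (C : {set {set U}}) m :
  realizable_in R C m -> exists2 d, is_euclidean_dim R C d & d <= m.
Proof.
move=> Cm; have exm : exists k, `[< realizable_in R C k >] by exists m; apply/asboolP.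
case: (ex_minnP exm) => d /asboolP Cd dmin.
have dle k : realizable_in R C k -> d <= k by move=> Ck; apply/dmin/asboolP.
by exists d; [split | apply: dle].
Qed.

Theorem corollary40 (R : realType) (U : finType) (C : {set {set U}}) :
  bouquet_of_downset_alignments C ->
  (forall e : U, exists2 X : {set U}, X \in C & e \in X) ->
  realizable R C /\
  exists2 d : nat, is_euclidean_dim R C d &
    d <= minn #|U| (#|maximal_members C| * VC_dim C).
Proof.
move=> bC coverC.
suff Cm : realizable_in R C (minn #|U| (#|maximal_members C| * VC_dim C)).
  split; last exact: realizable_euclidean_dim Cm.
  by exists (minn #|U| (#|maximal_members C| * VC_dim C)).
(* If [#|U|] is the smaller number, the chains are the singletons; otherwise they are the colour
   classes in the maximal members. *)
rewrite /minn; case: ifP => _.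
  apply: (@bouquet_realizable_in R U U C (fun e => [set e]%SET)) => //.
    by move=> x y z /set1P-> /set1P->; rewrite forced_refl.
  by move=> e; exists e; rewrite inE.
have [ch [ch_chain ch_cover]] := chain_cover bC coverC.
have := @bouquet_realizable_in R _ _ _ ch bC coverC ch_chain ch_cover.
by rewrite card_prod !card_ord.
Qed.
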